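(* For every $0<\varepsilon,\gamma\le \frac12$ and all sufficiently large $n$, there are instances of (unit-cost) \textsc{Set Cover} with $n$ cover-sets over a universe of $n$ items for which the integrality gap of the level-$\left\lfloor \frac{\gamma(\varepsilon-\varepsilon^2)}{1+\gamma}n\right\rfloor$ Sherali–Adams LP relaxation of the standard \textsc{Set Cover} LP is at least $\frac{1-\varepsilon}{1+\gamma}\ln n$.
   Context: A \textsc{Set Cover} instance has a universe $X$ and cover-sets $S_1,\dots,S_n\subseteq X$; with unit costs, its optimum $\mathrm{OPT}$ is the minimum number of cover-sets whose union is $X$. The standard LP relaxation has variables $y_1,\dots,y_n$ and constraints $\sum_{j: u\in S_j} y_j\ge 1$ for every $u\in X$ and $0\le y_j\le 1$ for all $j$. Sherali–Adams relaxation at level $\ell$: given a polytope over $y_1,\dots,y_n$ defined by finitely many linear constraints (including the box constraints $y_j\ge 0$ and $-y_j\ge -1$), the level-$\ell$ relaxation is the LP over variables $y_A$ for all $A\subseteq\{1,\dots,n\}$ with $|A|\le \ell+1$, with $y_\emptyset=1$, having, for every original constraint $\sum_{j=1}^n a_j y_j\ge b$ and every pair of disjoint sets $P,E\subseteq\{1,\dots,n\}$ with $|P|+|E|\le \ell$, the constraint $\sum_{j=1}^n a_j\sum_{T\subseteq E}(-1)^{|T|}y_{P\cup T\cup\{j\}}\ \ge\ b\sum_{T\subseteq E}(-1)^{|T|}y_{P\cup T}$. Its objective is to minimize $\sum_{j=1}^n y_{\{j\}}$. The integrality gap of an instance is $\mathrm{OPT}$ divided by the optimum value of this LP. *)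

(* Defs.v *)
(* classical_sets comes first so that set0, setT, \bigcup ... denote the finite-set
   notions of finset. *)
From mathcomp Require Import classical_sets reals exp.
From mathcomp Require Import all_boot all_order all_algebra.
Set Implicit Arguments. Unset Strict Implicit. Unset Printing Implicit Defensive.
Import Order.TTheory GRing.Theory Num.Theory.
Local Open Scope ring_scope.

(* The pair (a, b) stands for the constraint  \sum_j a_j y_j >= b. *)
Definition lin_constr (R : realType) (m : nat) : Type :=
  ({ffun 'I_m -> R} * R)%type.

(* A point of the lifted LP assigns a value to every y_A.  Only the sets A with
   #|A| <= l + 1 occur in the level-l constraints and in the objective, so the
   values of y on larger sets are irrelevant. *)
Definition sa_feasible (R : realType) (m : nat) (K : seq (lin_constr R m))
    (l : nat) (y : {set 'I_m} -> R) : Prop :=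
  y set0 = 1 /\
  forall c : lin_constr R m, c \in K ->
  forall P E : {set 'I_m}, [disjoint P & E] -> (#|P| + #|E| <= l)%N ->
    \sum_(j < m) c.1 j *
      (\sum_(T : {set 'I_m} | T \subset E) (-1) ^+ #|T| * y (j |: (P :|: T)))
    >= c.2 * (\sum_(T : {set 'I_m} | T \subset E) (-1) ^+ #|T| * y (P :|: T)).

Definition sa_objective (R : realType) (m : nat) (y : {set 'I_m} -> R) : R :=
  \sum_(j < m) y [set j].

(* inf is 0 by convention on an empty set.  For a coverable set cover instance
   over a nonempty universe the feasible set is nonempty (take y = 1) and the
   objective is at least 1 on it. *)
Definition sa_value (R : realType) (m : nat) (K : seq (lin_constr R m))
    (l : nat) : R :=
  inf [set v : R | exists y : {set 'I_m} -> R,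
                     sa_feasible K l y /\ v = sa_objective y]%classic.

(* An instance is a family S_0, ..., S_(m-1) of subsets of the universe X;
   a subfamily is given by its set C of indices. *)
Definition is_cover (X : finType) (m : nat) (S : 'I_m -> {set X})
    (C : {set 'I_m}) : bool :=
  \bigcup_(j in C) S j == [set: X].

Definition coverable (X : finType) (m : nat) (S : 'I_m -> {set X}) : bool :=
  is_cover S [set: 'I_m].

(* Meaningful for coverable instances only. *)
Definition set_cover_opt (X : finType) (m : nat) (S : 'I_m -> {set X}) : nat :=
  #|[arg min_(C < [set: 'I_m] | is_cover S C) #|C| ]|.

Definition set_cover_lp (R : realType) (X : finType) (m : nat)
    (S : 'I_m -> {set X}) : seq (lin_constr R m) :=
     [seq ([ffun j => (u \in S j)%:R], 1) | u <- enum X]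
  ++ [seq ([ffun j => (j == k)%:R], 0) | k <- enum 'I_m]
  ++ [seq ([ffun j => - (j == k)%:R], -1) | k <- enum 'I_m].

Definition sa_integrality_gap (R : realType) (X : finType) (m : nat)
    (S : 'I_m -> {set X}) (l : nat) : R :=
  (set_cover_opt S)%:R / sa_value (set_cover_lp R S) l.

(* Main.v *)
(* Fix k a little below eps n and put each item u in k cover-sets, indexed by T u.
   The k-subsets T u are chosen greedily: averaging over all k-subsets, some choice
   leaves at most a fraction 1 - rho of the surviving t-subfamilies meeting T u,
   where rho ~ (1 - eps) ^ t; after n items none survives if n ^ t exp (- rho n) < 1,
   which holds for t ~ (1 - eps) / eps ln n, so OPT > t.
   On the LP side y_A = q ^ #|A| (a product distribution) with
   q = (1 + gamma) / (eps n) is feasible: conditioning on the event (P, E) kills at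
   most l of the k variables of an item, and q (k - l) >= 1. *)
Require Import Defs.
From mathcomp Require Import classical_sets reals sequences exp.
From mathcomp Require Import all_boot all_order all_algebra.
From mathcomp Require Import ring lra zify.
Set Implicit Arguments. Unset Strict Implicit. Unset Printing Implicit Defensive.
Import Order.TTheory GRing.Theory Num.Theory.
Local Open Scope ring_scope.

(** * Product distributions in the Sherali-Adams relaxation *)

(** Inclusion-exclusion for the probability that a product distribution takes all of [B] and nothing
    of [E]. The sum expands a product over indices, whose factor is q - q = 0 at an index lying in
    both sets. *)
Lemma alternating_sum_expr (R : comNzRingType) (I : finType) (q : R)
    (B E : {set I}) :
  \sum_(T : {set I} | T \subset E) (-1) ^+ #|T| * q ^+ #|B :|: T| =
  if [disjoint B & E] then q ^+ #|B| * (1 - q) ^+ #|E| else 0.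
Proof.
have exprE (x : R) (A : {set I}) : x ^+ #|A| = \prod_i (if i \in A then x else 1).
  by rewrite -big_mkcond prodr_const.
pose F i := if i \in E then - q else 0.
pose G i := if i \in B then q else 1.
transitivity (\prod_i (F i + G i)).
  rewrite bigA_distr [RHS](bigID (fun T : {set I} => T \subset E)) /=.
  rewrite [X in _ + X]big1 ?addr0; last first.
    move=> T /subsetPn[i iT iE].
    by rewrite (bigD1 i) //= iT /F (negPf iE) mul0r.
  apply: eq_bigr => T TE; rewrite !exprE -big_split; apply: eq_bigr => i _ /=.
  rewrite inE /F /G; case: (boolP (i \in T)) => iT; last by rewrite orbF mul1r.
  by rewrite (subsetP TE) // orbT mulN1r.
case: ifPn => [BE|]; last first.
  move=> /pred0Pn[i /= /andP[iB iE]].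
  by rewrite (bigD1 i) //= /F /G iB iE addNr mul0r.
rewrite !exprE -big_split; apply: eq_bigr => i _ /=; rewrite /F /G.
have [iE|iE] := boolP (i \in E); last by rewrite add0r mulr1.
by rewrite (disjointFl BE iE) addrC mul1r.
Qed.

Section ProductPoint.
Variables (R : realType) (m : nat) (q : R).
Hypothesis q01 : 0 <= q <= 1.

(* The value of the j-th variable under the product distribution, conditioned
   on taking all of P and nothing of E. *)
Let marginal (P E : {set 'I_m}) j : R :=
  if j \in P then 1 else if j \in E then 0 else q.

(** By independence, both sides of a lifted constraint carry the weight [w] >= 0 of the event (P,
    E); what remains is the original constraint at the conditional marginals. *)
Lemma product_point_feasible (K : seq (lin_constr R m)) (l : nat) :
  (forall c, c \in K -> forall P E : {set 'I_m}, [disjoint P & E] ->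
    (#|P| + #|E| <= l)%N -> c.2 <= \sum_j c.1 j * marginal P E j) ->
  sa_feasible K l (fun A => q ^+ #|A|).
Proof.
move=> KP; split=> [|c cK P E PE PEl]; first by rewrite cards0.
have /andP[q0 q1] := q01.
rewrite alternating_sum_expr PE; set w := q ^+ #|P| * _.
have w0 : 0 <= w by rewrite mulr_ge0 ?exprn_ge0 ?subr_ge0.
have -> : \sum_(j < m) c.1 j *
    (\sum_(T : {set 'I_m} | T \subset E) (-1) ^+ #|T| * q ^+ #|j |: (P :|: T)|) =
    (\sum_j c.1 j * marginal P E j) * w.
  rewrite mulr_suml; apply: eq_bigr => j _.
  under eq_bigr => T _ do rewrite setUA.
  rewrite alternating_sum_expr -mulrA; congr (_ * _); rewrite /marginal.
  have [jP|jP] := boolP (j \in P).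
    by rewrite (setUidPr _) ?sub1set // PE mul1r.
  have [jE|jE] := boolP (j \in E).
    rewrite mul0r ifN //; apply/pred0Pn; exists j.
    by rewrite /= jE !inE eqxx.
  by rewrite -setI_eq0 setIUl setU_eq0 !setI_eq0 disjoints1 jE PE cardsU1 jP exprS mulrA.
by apply: ler_wpM2r => //; apply: KP.
Qed.

Lemma product_point_set_cover_feasible (X : finType) (S : 'I_m -> {set X})
    (l k : nat) :
  (forall u, (k <= #|[set j | u \in S j]|)%N) -> (l <= k)%N ->
  1 <= q * (k - l)%:R ->
  sa_feasible (set_cover_lp R S) l (fun A => q ^+ #|A|).
Proof.
move=> Sk lk qkl; have /andP[q0 q1] := q01.
have marginal01 P E j : 0 <= marginal P E j <= 1.
  by rewrite /marginal; case: ifP => _; [|case: ifP => _]; rewrite ?lexx ?ler01 ?q01.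
have sum_delta (a : R) (F : 'I_m -> R) i : \sum_j (a * (j == i)%:R) * F j = a * F i.
  rewrite (bigD1 i) //= eqxx mulr1 big1 ?addr0 // => j /negPf ->.
  by rewrite mulr0 mul0r.
apply: product_point_feasible => c cK P E PE PEl.
move: cK; rewrite !mem_cat => /or3P[] /mapP[u _ ->] /=.
- under eq_bigr => j _ do rewrite ffunE.
  set U := [set j | u \in S j].
  have -> : \sum_j (u \in S j)%:R * marginal P E j = \sum_(j in U) marginal P E j.
    rewrite [RHS]big_mkcond; apply: eq_bigr => j _.
    by rewrite inE; case: (u \in S j); rewrite ?mul1r ?mul0r.
  have m0 j : 0 <= marginal P E j by case/andP: (marginal01 P E j).
  (* If [P] already picks a set containing [u], its marginal 1 suffices. Otherwise at least k - #|E|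
     >= k - l variables of [u] keep the value q. *)
  have [UP|/pred0Pn[j /= /andP[jU jP]]] := boolP [disjoint U & P]; last first.
    rewrite (bigD1 j) //= /(marginal _ _ j) jP lerDl sumr_ge0 //.
  rewrite (big_setID E) /= -[X in X <= _]add0r lerD ?sumr_ge0 //.
  apply: le_trans qkl _; rewrite (eq_bigr (fun=> q)) => [|j]; last first.
    rewrite !inE => /andP[jE jU]; rewrite /marginal (negPf jE).
    by rewrite (disjointFr UP) // inE.
  rewrite sumr_const -[in leRHS]mulr_natr ler_wpM2l // ler_nat cardsD.
  have := Sk u; rewrite -/U => kU.
  have : (#|U :&: E| <= #|E|)%N by rewrite subset_leq_card ?subsetIr.
  lia.
- under eq_bigr => j _ do rewrite ffunE -[_%:R]mul1r.
  by rewrite sum_delta mul1r; case/andP: (marginal01 P E u).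
- under eq_bigr => j _ do rewrite ffunE -mulN1r.
  by rewrite sum_delta mulN1r lerN2; case/andP: (marginal01 P E u).
Qed.

End ProductPoint.

(** * Bounds on the LP value *)

(** The constraints with P and E empty form the basic LP, where the objective dominates the left
    side of the constraint of [u]. *)
Lemma sa_objective_set_cover_ge1 (R : realType) (X : finType) (m l : nat)
    (S : 'I_m -> {set X}) (y : {set 'I_m} -> R) (u : X) :
  sa_feasible (set_cover_lp R S) l y -> 1 <= sa_objective y.
Proof.
case=> y0 yK.
have sum0 (f : {set 'I_m} -> R) : \sum_(T : {set 'I_m} | T \subset set0) f T = f set0.
  by rewrite (eq_bigl (pred1 set0)) ?big_pred1_eq // => T; rewrite subset0.
have yc c : c \in set_cover_lp R S -> c.2 <= \sum_j c.1 j * y [set j].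
  move=> /yK/(_ set0 set0); rewrite -setI_eq0 setI0 eqxx cards0 => /(_ isT isT).
  rewrite sum0 cards0 expr0 mul1r setU0 y0 mulr1 => /le_trans; apply.
  by apply: ler_sum => j _; rewrite sum0 cards0 mul1r !setU0.
have y_ge0 j : 0 <= y [set j].
  have /yc /= : ([ffun i => (i == j)%:R], 0) \in set_cover_lp R S.
    by rewrite !mem_cat map_f ?orbT ?mem_enum.
  rewrite (bigD1 j) //= ffunE eqxx mul1r big1 ?addr0 // => i /negPf ij.
  by rewrite ffunE ij mul0r.
have /yc /= : ([ffun j => (u \in S j)%:R], 1) \in set_cover_lp R S.
  by rewrite mem_cat map_f ?mem_enum.
move=> /le_trans; apply; apply: ler_sum => j _; rewrite ffunE.
by case: (u \in S j); rewrite ?mul1r ?mul0r.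
Qed.

(** The lower bound keeps the denominator of the integrality gap positive. *)
Lemma sa_value_set_cover_bounds (R : realType) (X : finType) (m l : nat)
    (S : 'I_m -> {set X}) (y : {set 'I_m} -> R) (u : X) :
  sa_feasible (set_cover_lp R S) l y ->
  1 <= sa_value (set_cover_lp R S) l <= sa_objective y.
Proof.
move=> yf; rewrite /sa_value; set V := (X in inf X).
have V1 : lbound V 1 by move=> v [z [zf ->]]; exact: sa_objective_set_cover_ge1 u zf.
have yV : V (sa_objective y) by exists y.
apply/andP; split; first by apply: lb_le_inf => //; exists (sa_objective y).
by apply: ge_inf => //; exists 1.
Qed.

(** * Binomial estimates and greedy draws *)

Lemma bin_le_expn (n t : nat) : ('C(n, t) <= n ^ t)%N.
Proof.
apply: (@leq_trans (falling_factorial n t)).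
  by rewrite -bin_ffact leq_pmulr ?fact_gt0.
elim: t => [|t IHt]; first by rewrite ffactn0.
by rewrite ffactnSr expnSr leq_mul // leq_subr.
Qed.

(** The quotient of the binomials is the product over i < t of (n - i - k) / (n - i), and each
    factor is at least 1 - e. *)
Lemma bin_ratio_ge (R : realFieldType) (e : R) (n t k : nat) :
  0 <= e <= 1 -> (t <= n)%N -> k%:R <= e * (n - t)%:R ->
  (1 - e) ^+ t * 'C(n, k)%:R <= 'C(n - t, k)%:R.
Proof.
move=> /andP[e0 e1]; elim: t => [|t IHt] tn ke.
  by rewrite subn0 expr0 mul1r.
have N0 : 0 < (n - t)%:R :> R by rewrite ltr0n subn_gt0.
have keN : k%:R <= e * (n - t)%:R.
  by apply: le_trans ke _; rewrite ler_wpM2l // ler_nat leq_sub.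
have kN : (k <= n - t)%N.
  by rewrite -(ler_nat R); apply: le_trans keN _; rewrite ler_piMl // ltW.
rewrite exprS -mulrA; apply: le_trans (_ : (1 - e) * 'C(n - t, k)%:R <= _).
  by rewrite ler_wpM2l ?subr_ge0 // IHt // ltnW.
rewrite -(ler_pM2l N0) -[in leRHS]natrM subnS mul_bin_down natrM mulrA (natrB _ kN).
by rewrite ler_wpM2r // mulrBr mulr1 lerB // mulrC.
Qed.

Lemma card_draws_disjoint (I : finType) (C : {set I}) (k : nat) :
  #|[set T : {set I} | [disjoint C & T] & #|T| == k]| = 'C(#|I| - #|C|, k).
Proof.
have -> : (#|I| - #|C| = #|~: C|)%N by rewrite [RHS]cardsCs setCK.
rewrite -cards_draws; apply: eq_card => T.
by rewrite !inE disjoint_sym disjoints_subset.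
Qed.

(* Averaging over all k-subsets T. *)
Lemma exists_draw_avoiding (R : realFieldType) (I : finType)
    (D : {set {set I}}) (t k : nat) (rho : R) :
  (forall C, C \in D -> #|C| = t) -> (k <= #|I|)%N ->
  rho * 'C(#|I|, k)%:R <= 'C(#|I| - t, k)%:R ->
  exists T : {set I}, #|T| = k /\
    #|[set C in D | ~~ [disjoint C & T]]|%:R <= (1 - rho) * #|D|%:R.
Proof.
move=> Dt kI rhoC.
pose good (T : {set I}) := #|[set C in D | [disjoint C & T]]|.
have [/existsP[T /andP[/eqP Tk rhoT]]|/existsPn small] :=
    boolP [exists T : {set I}, (#|T| == k) && (rho * #|D|%:R <= (good T)%:R)].
  exists T; split=> //; rewrite mulrBl mul1r lerBrDr.
  apply: le_trans (lerD (lexx _) rhoT) _.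
  rewrite -natrD ler_nat /good -(cardsID [set C : {set I} | [disjoint C & T]] D) addnC.
  apply: eq_leq; congr (_ + _)%N; apply: eq_card => C; rewrite !inE //.
  by rewrite andbC.
(* Double counting of disjoint pairs (C, T). If every k-subset were below the average, the total
   would be too small. *)
have dcount : (\sum_(T : {set I} | #|T| == k) good T = #|D| * 'C(#|I| - t, k))%N.
  have goodE T : good T = (\sum_(C in D) if [disjoint C & T] then 1 else 0)%N.
    by rewrite /good -sum1_card -big_mkcondr; apply: eq_bigl => C; rewrite inE.
  rewrite -sum_nat_const (eq_bigr _ (fun T _ => goodE T)).
  rewrite exchange_big; apply: eq_bigr => C CD /=.
  rewrite -(Dt C CD) -card_draws_disjoint -sum1_card -big_mkcondr.
  by apply: eq_bigl => T; rewrite inE andbC.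
have : (\sum_(T : {set I} | #|T| == k) good T)%:R
    < \sum_(T : {set I} | #|T| == k) rho * #|D|%:R.
  rewrite natr_sum; apply: ltr_sum => [|T Tk].
    have : (0 < #|[set T : {set I} | #|T| == k]|)%N by rewrite card_draws bin_gt0.
    by move=> /card_gt0P[T]; rewrite inE => Tk; apply/hasP; exists T; rewrite ?mem_index_enum.
  by move: (small T); rewrite Tk /= ltNge.
have cardk : #|[pred T : {set I} | #|T| == k]| = 'C(#|I|, k).
  by rewrite -card_draws cardsE.
rewrite dcount sumr_const cardk natrM -[X in _ < X -> _]mulr_natr.
by rewrite ltNge mulrAC mulrC ler_wpM2l // mulrC.
Qed.

(** Each new draw shrinks the family of [t]-subsets meeting all draws by a factor 1 - rho; after [m]
    draws its size is below 1, so it is empty. *)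
Lemma exists_draws_hitting (R : realFieldType) (I : finType) (t k m : nat)
    (rho : R) :
  (k <= #|I|)%N -> rho <= 1 -> rho * 'C(#|I|, k)%:R <= 'C(#|I| - t, k)%:R ->
  'C(#|I|, t)%:R * (1 - rho) ^+ m < 1 ->
  exists T : 'I_m -> {set I}, (forall u, #|T u| = k) /\
    forall C : {set I}, (#|C| <= t)%N -> (t <= #|I|)%N ->
      exists u, [disjoint C & T u].
Proof.
move=> kI rho1 rhoC small.
have [T [Tk TD]] : exists T : 'I_m -> {set I}, (forall u, #|T u| = k) /\
    #|[set C : {set I} | (#|C| == t) && [forall u, ~~ [disjoint C & T u]]]|%:R
      <= 'C(#|I|, t)%:R * (1 - rho) ^+ m.
  elim: m {small} => [|m [T [Tk TD]]].
    exists (fun=> set0); split=> [[] //|]; rewrite expr0 mulr1 ler_nat.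
    rewrite -card_draws subset_leq_card //; apply/subsetP => C.
    by rewrite !inE => /andP[].
  set D := [set C | _] in TD.
  have Dt C : C \in D -> #|C| = t by rewrite inE => /andP[/eqP].
  have [T' [T'k T'D]] := exists_draw_avoiding Dt kI rhoC.
  exists (fun u => if unlift ord0 u is Some v then T v else T'); split=> [u|].
    by case: unlift.
  apply: le_trans (_ : (1 - rho) * #|D|%:R <= _); last first.
    by rewrite exprSr mulrA [in leRHS]mulrC ler_wpM2l ?subr_ge0.
  apply: le_trans T'D; rewrite ler_nat subset_leq_card //; apply/subsetP => C.
  rewrite !inE => /andP[-> /forallP CT] /=.
  apply/andP; split; last by have := CT ord0; rewrite unlift_none.
  by apply/forallP => v; have := CT (lift ord0 v); rewrite liftK.
exists T; split=> // C Ct tI.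
(* A smaller [C] is padded to exactly [t] elements; disjointness passes back to the subset. *)
have [s [us sz sC]] : exists s : seq I,
    [/\ uniq s, size s = (t - #|C|)%N & {subset s <= ~: C}].
  by apply/card_geqP; rewrite [leqRHS]cardsCs setCK leq_sub2r.
pose C' := C :|: [set x in s].
have C't : #|C'| = t.
  rewrite cardsU (_ : C :&: _ = set0) ?cards0 ?subn0.
    by rewrite cardsE (card_uniqP us) sz subnKC.
  apply/setP => x; rewrite !inE; apply: contraTF isT => /andP[xC /sC].
  by rewrite inE xC.
have D0 : [set C : {set I} | (#|C| == t) && [forall u, ~~ [disjoint C & T u]]] = set0.
  by apply/cards0_eq/eqP; rewrite -leqn0 -ltnS -(ltr_nat R) (le_lt_trans TD).
have : C' \notin [set C : {set I} | (#|C| == t) && [forall u, ~~ [disjoint C & T u]]].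
  by rewrite D0 inE.
rewrite inE C't eqxx negb_forall => /existsP[u /negPn Cu]; exists u.
by apply: disjointWl Cu; exact: subsetUl.
Qed.

(** Transposing the incidence turns covers into hitting sets: [C] covers [u] iff it meets [T u]. *)
Lemma exists_large_opt_instance (R : realFieldType) (n t k : nat) (rho : R) :
  (0 < k <= n)%N -> (t <= n)%N -> rho <= 1 ->
  rho * 'C(n, k)%:R <= 'C(n - t, k)%:R ->
  'C(n, t)%:R * (1 - rho) ^+ n < 1 ->
  exists S : 'I_n -> {set 'I_n},
    [/\ coverable S, forall u, #|[set j | u \in S j]| = k &
        (t < set_cover_opt S)%N].
Proof.
move=> /andP[k0 kn] tn rho1; have cardI := card_ord n.
rewrite -{1 2 3}cardI => rhoC small.
have kI : (k <= #|'I_n|)%N by rewrite cardI.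
have [T [Tk Thit]] := exists_draws_hitting kI rho1 rhoC small.
pose S j := [set u | j \in T u].
have degS u : [set j | u \in S j] = T u by apply/setP => j; rewrite !inE.
have covS : coverable S.
  rewrite /coverable /is_cover -subTset; apply/subsetP => u _.
  have /card_gt0P[j jT] : (0 < #|T u|)%N by rewrite Tk.
  by apply/bigcupP; exists j; rewrite ?inE.
exists S; split=> // [u|]; first by rewrite degS Tk.
rewrite /set_cover_opt; case: arg_minnP => // C covC _; rewrite ltnNge.
apply/negP => Ct; have [|u] := Thit C Ct; first by rewrite card_ord.
move=> /pred0P CT; have : u \in \bigcup_(j in C) S j by rewrite (eqP covC) inE.
by move=> /bigcupP[j jC]; rewrite inE => jT; have := CT j; rewrite /= jC jT.
Qed.

(** * Exponential estimates *)

(** A cubic beats a quadratic: the exponential is the cube of expR (b * x) >= 1 + b * x. *)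
Lemma expR_gt_sqr (R : realType) (a M : R) : 0 < a -> 0 <= M ->
  exists X : R, forall x, X <= x -> M * x ^+ 2 < expR (a * x).
Proof.
move=> a0 M0; pose b := a / 3; have b0 : 0 < b by rewrite divr_gt0.
exists (M / b ^+ 3 + 1) => x Xx.
have Mb : 0 <= M / b ^+ 3 by rewrite divr_ge0 // exprn_ge0 // ltW.
have x0 : 0 < x by lra.
have Mx : M <= b ^+ 3 * x.
  by rewrite mulrC -ler_pdivrMr ?exprn_gt0 //; lra.
have -> : a * x = 3%:R * (b * x) by rewrite /b; field.
rewrite expRM_natl; apply: (@lt_le_trans _ _ ((1 + b * x) ^+ 3)); last first.
  by rewrite lerXn2r ?nnegrE ?expR_ge0 ?expR_ge1Dx // addr_ge0 // mulr_ge0 // ltW.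
apply: (@le_lt_trans _ _ (b ^+ 3 * x * x ^+ 2)).
  by rewrite ler_wpM2r // exprn_ge0 // ltW.
have bx0 : 0 < b * x by rewrite mulr_gt0.
have -> : b ^+ 3 * x * x ^+ 2 = (b * x) ^+ 3 by ring.
by rewrite ltrXn2r // ?nnegrE; lra.
Qed.

(** Invert 1 / (1 - e) = 1 + e / (1 - e) <= expR (e / (1 - e)) and take powers. *)
Lemma expr_1B_ge (R : realType) (e : R) (t : nat) : e < 1 ->
  expR (- (t%:R * (e / (1 - e)))) <= (1 - e) ^+ t.
Proof.
move=> e1; have e0 : 0 < 1 - e by rewrite subr_gt0.
rewrite -mulrN expRM_natl lerXn2r ?nnegrE ?expR_ge0 //; first exact: ltW.
rewrite expRN -[leRHS]invrK lef_pV2 ?posrE ?invr_gt0 ?expR_gt0 //.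
apply: le_trans (expR_ge1Dx _); rewrite le_eqVlt; apply/orP; left; apply/eqP.
by field; lra.
Qed.

(** The product is at most n ^ t * expR (- rho n). *)
Lemma bin_mul_expr_1B_lt1 (R : realType) (n t : nat) (rho : R) :
  (0 < n)%N -> rho <= 1 -> t%:R * ln n%:R < rho * n%:R ->
  'C(n, t)%:R * (1 - rho) ^+ n < 1.
Proof.
move=> n0 rho1 trho; have nR : 0 < n%:R :> R by rewrite ltr0n.
apply: (@le_lt_trans _ _ (expR (t%:R * ln n%:R) * expR (- (rho * n%:R)))).
  apply: ler_pM; rewrite ?exprn_ge0 ?subr_ge0 //.
    by rewrite expRM_natl lnK ?posrE // -natrX ler_nat bin_le_expn.
  rewrite -mulNr expRM_natr lerXn2r ?nnegrE ?subr_ge0 ?expR_ge0 //.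
  exact: expR_ge1Dx.
by rewrite -expRD expR_lt1 subr_lt0.
Qed.

(** * Choice of parameters and the gap *)

Theorem theorem2 (R : realType) (eps gamma : R) :
  0 < eps <= 1 / 2 -> 0 < gamma <= 1 / 2 ->
  exists N : nat, forall n : nat, (N <= n)%N ->
  exists S : 'I_n -> {set 'I_n},
    coverable S /\
    sa_integrality_gap R S
      (Num.truncn (gamma * (eps - eps ^+ 2) / (1 + gamma) * n%:R))
    >= (1 - eps) / (1 + gamma) * ln n%:R.
Proof.
move=> /andP[eps0 eps1] /andP[gamma0 gamma1].
have g1 : 0 < 1 + gamma by lra.
(* Since l <= d (1 - eps) n and k > (1 - d) eps n, the difference k - l exceeds (eps - d) n, and
   this [d] makes eps - d = eps / (1 + gamma). *)
pose d := gamma * eps / (1 + gamma).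
have d0 : 0 < d by rewrite divr_gt0 ?mulr_gt0.
have d1 : d < 1 by rewrite ltr_pdivrMr //; nra.
(* Items belong to k ~ (1 - d) eps n sets, so a density e slightly above
   (1 - d) eps survives the removal of t = O(ln n) sets, while e < eps makes
   the exponent c of (1 - e) ^+ t >= n ^ (- c) smaller than 1. *)
pose e := (1 - d / 2) * eps.
have e0 : 0 < e by rewrite mulr_gt0 //; lra.
have e_eps : e < eps by rewrite /e; nra.
pose c := (1 - eps) / eps * (e / (1 - e)).
have c1 : 0 < 1 - c.
  have ne : 1 - e != 0 by rewrite gt_eqF //; lra.
  have -> : 1 - c = (1 - e - (1 - eps) * (e / eps)) / (1 - e).
    by rewrite /c; field; rewrite ne gt_eqF.
  have -> : e / eps = 1 - d / 2 by rewrite mulfK // gt_eqF.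
  rewrite divr_gt0 //; first by rewrite /e; nra.
  lra.
have deps0 : 0 < d * eps by rewrite mulr_gt0.
have ieps0 : 0 < eps^-1 by rewrite invr_gt0.
have M0 : 0 <= 2 / (d * eps) * (1 + eps^-1).
  by rewrite mulr_ge0 // ?divr_ge0 //; lra.
(* For x = ln n, [HX1] will give 1 + t <= d eps n / 2, and [HX2] will give x ^ 2 / eps < n ^ (1 -
   c). *)
have [X1 HX1] := expR_gt_sqr ltr01 M0.
have [X2 HX2] := expR_gt_sqr c1 (ltW ieps0).
pose X := Num.max 1 (Num.max X1 X2).
exists (Num.truncn (expR X)).+1 => n nX.
have Xn : expR X < n%:R.
  by apply: lt_le_trans (truncnS_gt _) _; rewrite ler_nat.
have n0 : 0 < n%:R :> R by apply: lt_trans Xn; exact: expR_gt0.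
pose x := ln n%:R : R.
have xn : expR x = n%:R by rewrite lnK ?posrE.
have Xx : X <= x by rewrite -ler_expR xn ltW.
have /and3P[x1 xX1 xX2] : [&& 1 <= x, X1 <= x & X2 <= x] by rewrite !ge_max in Xx.
(* Rounding down loses nothing: the optimum will be at least t + 1. *)
pose t := Num.truncn ((1 - eps) / eps * x).
have /andP[tle tgt] : t%:R <= (1 - eps) / eps * x < t.+1%:R.
  by apply: truncn_itv; rewrite mulr_ge0 ?divr_ge0 //; lra.
have tx : t%:R <= eps^-1 * x.
  apply: le_trans tle _; rewrite ler_wpM2r //; first lra.
  by rewrite mulrBl mul1r divff ?gt_eqF //; lra.
pose k := (Num.truncn ((1 - d) * eps * n%:R)).+1.
have /andP[kle kgt] : k%:R - 1 <= (1 - d) * eps * n%:R < k%:R.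
  rewrite /k -natr1 addrK natr1; apply: truncn_itv.
  by rewrite !mulr_ge0 //; lra.
(* The 1 absorbs the rounding up in [k], and t the removal of t sets; both fit in the slack d eps n
   / 2 between e n and (1 - d) eps n. *)
have tn_real : 1 + t%:R <= d * eps / 2 * n%:R.
  have := HX1 x xX1; rewrite mul1r xn => H.
  have -> : 1 + t%:R = d * eps / 2 * (2 / (d * eps) * (1 + t%:R)).
    by field; rewrite !gt_eqF.
  rewrite ler_wpM2l //; first lra.
  apply: ltW; apply: le_lt_trans H; rewrite -[leRHS]mulrA ler_wpM2l //.
    by rewrite ltW // divr_gt0.
  have x_sqr : x <= x ^+ 2 by rewrite expr2 ler_peMl //; lra.
  rewrite mulrDl mul1r lerD //; first lra.
  by apply: le_trans tx _; rewrite ler_wpM2l // ltW.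
have deps1 : d * eps <= eps by rewrite ler_piMl // ltW.
have t0 : 0 <= t%:R :> R by [].
have tn : (t <= n)%N by rewrite -(ler_nat R); nra.
have ke : k%:R <= e * (n - t)%:R by rewrite natrB // /e; nra.
have kn : (k <= n)%N.
  by rewrite -(ler_nat R); apply: le_trans ke _; rewrite natrB //; nra.
pose rho := (1 - e) ^+ t.
have rho1 : rho <= 1 by apply: exprn_ile1; lra.
have rho_bin : rho * 'C(n, k)%:R <= 'C(n - t, k)%:R.
  by apply: bin_ratio_ge => //; lra.
(* The chain is t x <= x ^ 2 / eps < n ^ (1 - c) <= rho n. *)
have rho_n : t%:R * ln n%:R < rho * n%:R.
  apply: (@le_lt_trans _ _ (eps^-1 * x ^+ 2)); first by rewrite -/x; nra.
  apply: lt_le_trans (HX2 x xX2) _.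
  have -> : (1 - c) * x = - (c * x) + x by ring.
  rewrite expRD xn ler_wpM2r //.
  apply: le_trans (expr_1B_ge t _); last lra.
  rewrite ler_expR lerN2 /c.
  have -> : (1 - eps) / eps * (e / (1 - e)) * x =
      (1 - eps) / eps * x * (e / (1 - e)) by ring.
  by rewrite ler_wpM2r // divr_ge0 //; lra.
have n_gt0 : (0 < n)%N by rewrite -(ltr_nat R).
have small := bin_mul_expr_1B_lt1 n_gt0 rho1 rho_n.
have k0n : (0 < k <= n)%N by [].
have [S [covS degS optS]] := exists_large_opt_instance k0n tn rho1 rho_bin small.
exists S; split=> //; set l := Num.truncn _.
pose q := (1 + gamma) / (eps * n%:R).
have en0 : 0 < eps * n%:R by rewrite mulr_gt0.
have q01 : 0 <= q <= 1.
  apply/andP; split; first by apply: divr_ge0; exact: ltW.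
  (* [tn_real] and d < 1 give eps n > 2 >= 1 + gamma. *)
  by rewrite ler_pdivrMr // mul1r; nra.
have l_le : l%:R <= gamma * (eps - eps ^+ 2) / (1 + gamma) * n%:R.
  by rewrite truncn_le mulr_ge0 // divr_ge0 ?(ltW g1) // mulr_ge0 ?(ltW gamma0) //; nra.
have kl : eps * n%:R / (1 + gamma) <= k%:R - l%:R.
  suff -> : eps * n%:R / (1 + gamma) = (1 - d) * eps * n%:R
      - gamma * (eps - eps ^+ 2) / (1 + gamma) * n%:R by lra.
  by rewrite /d; field; rewrite gt_eqF.
have lk : (l <= k)%N.
  rewrite -(ler_nat R) -subr_ge0; apply: le_trans kl.
  by apply: divr_ge0; exact: ltW.
have qkl : 1 <= q * (k - l)%:R.
  rewrite natrB //; apply: le_trans (ler_wpM2l _ kl); last by case/andP: q01.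
  by rewrite /q mulrA divfK ?gt_eqF // divff ?gt_eqF.
have degS_ge u : (k <= #|[set j | u \in S j]|)%N by rewrite degS.
have feas := product_point_set_cover_feasible q01 degS_ge lk qkl.
have /andP[v1 vq] := sa_value_set_cover_bounds (Ordinal n_gt0) feas.
have objE : sa_objective (fun A : {set 'I_n} => q ^+ #|A|) = (1 + gamma) / eps.
  rewrite /sa_objective; under eq_bigr => j _ do rewrite cards1 expr1.
  rewrite sumr_const card_ord -[LHS]mulr_natr /q; field.
  by rewrite !gt_eqF.
rewrite {}objE in vq; rewrite /sa_integrality_gap.
have v0 := lt_le_trans ltr01 v1.
rewrite ler_pdivlMr // -/x.
have opt_ge : (1 - eps) / eps * x <= (set_cover_opt S)%:R.
  by apply: le_trans (ltW tgt) _; rewrite ler_nat.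
apply: le_trans opt_ge.
have -> : (1 - eps) / eps * x = (1 - eps) / (1 + gamma) * x * ((1 + gamma) / eps).
  by field; rewrite !gt_eqF.
by rewrite ler_wpM2l // mulr_ge0 ?divr_ge0 //; lra.
Qed.
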